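(* Let $n\ge4$ and $m\ge1$ be integers and let $0\le\bar\nu<1/2$. Then for any estimator $\hat y=\hat y(X)\in[0,1]^m$, $$\sup_{y\in\{0,1\}^m,\ p\in\mathcal P_{\bar\nu}}E_{p,y}\left(\frac1m\sum_{j=1}^m|\hat y_j-y_j|\right)\ge\frac1{8(6e)^2}\exp(-6n\bar\nu),$$ where $\mathcal P_{\bar\nu}=\left\{(p_1,\dots,p_n)\in[0,1]^n:\frac1n\sum_{i=1}^n(2p_i-1)^2=\bar\nu\right\}$.
   Context: For $p\in[0,1]^n$ and $y\in\{0,1\}^m$, $E_{p,y}$ denotes expectation when $X=(X_{ij})\in\{0,1\}^{n\times m}$ has distribution $$P_{p,y}(X)=\prod_{j=1}^m\prod_{i=1}^np_i^{\mathbb I\{X_{ij}=y_j\}}(1-p_i)^{\mathbb I\{X_{ij}=1-y_j\}},$$ i.e. the $X_{ij}$ are independent and $X_{ij}=y_j$ with probability $p_i$. An estimator is any function of $X$ with values in $[0,1]^m$. *)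

(* Defs.v *)
From HB Require Import structures.
From mathcomp Require Import all_boot all_order all_algebra.
From mathcomp Require Import all_classical all_reals all_analysis.

Set Implicit Arguments.
Unset Strict Implicit.
Unset Printing Implicit Defensive.

Import Order.TTheory GRing.Theory Num.Theory.

Local Open Scope classical_set_scope.
Local Open Scope ring_scope.

Section Crowdsourcing.
Variables (R : realType) (n m : nat).

(* Labels in {0,1} are booleans ([true] is 1), so 1 - y_j is [~~ y j];
   the exponents are indicators, through the coercion from bool to nat. *)
Definition label_prob (p : 'I_n -> R) (y : 'I_m -> bool)
    (X : 'M[bool]_(n, m)) : R :=
  \prod_(j < m) \prod_(i < n)
    (p i ^+ (X i j == y j) * (1 - p i) ^+ (X i j == ~~ y j)).

Definition expectation_py (p : 'I_n -> R) (y : 'I_m -> bool)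
    (f : 'M[bool]_(n, m) -> R) : R :=
  \sum_(X : 'M[bool]_(n, m)) label_prob p y X * f X.

Definition is_estimator (yhat : 'M[bool]_(n, m) -> 'I_m -> R) : Prop :=
  forall X j, 0 <= yhat X j <= 1.

Definition label_loss (yh : 'I_m -> R) (y : 'I_m -> bool) : R :=
  m%:R^-1 * \sum_(j < m) `|yh j - (y j)%:R|.

Definition ability_class (nu : R) : set ('I_n -> R) :=
  [set p | (forall i, 0 <= p i <= 1) /\
           n%:R^-1 * \sum_(i < n) (2 * p i - 1) ^+ 2 = nu].

End Crowdsourcing.

(* Main.v *)
Require Import Defs.
From HB Require Import structures.
From mathcomp Require Import all_boot all_order all_algebra.
From mathcomp Require Import all_classical all_reals all_analysis.
From mathcomp Require Import ring lra.

(** Take all abilities equal to [(1 + sqrt nubar) / 2] and bound the maximal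
    risk over the labels by the average risk.  Flipping the label of the [j]-th
    task pairs up the label vectors; within a pair, the [j]-th losses add up to
    [1], so the risk is controlled by the Hellinger affinity
    [\prod_i 2 sqrt (p_i (1 - p_i))] of the two laws.  This gives the bound
    [(1 - nubar)^n / 4], and [1 - nubar >= exp (- 2 nubar)] for
    [nubar <= 1/2]. *)

Set Implicit Arguments.
Unset Strict Implicit.
Unset Printing Implicit Defensive.

Import Order.TTheory GRing.Theory Num.Theory.

Local Open Scope classical_set_scope.
Local Open Scope ring_scope.

(** Distributivity, a matrix being a choice of one value per index pair. It gives both the total
    mass of a law and the Hellinger affinity. *)
Lemma sum_mx_prod (R : comPzRingType) (T : finType) (n m : nat)
    (F : 'I_n -> 'I_m -> T -> R) :
  \sum_(X : 'M[T]_(n, m)) \prod_(j < m) \prod_(i < n) F i j (X i j) =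
  \prod_(j < m) \prod_(i < n) \sum_(t : T) F i j t.
Proof.
rewrite exchange_big pair_bigA /=.
rewrite (bigA_distr_bigA (fun (ij : 'I_n * 'I_m) t => F ij.1 ij.2 t)) /=.
rewrite [RHS](reindex (@mx_val T n m)) /=; last first.
  by exists (@Matrix T n m) => // -[].
apply: eq_bigr => X _; rewrite exchange_big pair_bigA /=.
by apply: eq_bigr => -[i j] _.
Qed.

(* The left side is linear in [g] and [a + b] and lies below
   [g ^+ 2 / (a + b) <= min a b]; summing over outcomes and then optimising [l]
   replaces Cauchy-Schwarz. *)
Lemma mix_ge_geom (R : realFieldType) (a b g l u : R) :
  0 <= a -> 0 <= b -> g ^+ 2 = a * b -> 0 <= u <= 1 ->
  2 * l * g - l ^+ 2 * (a + b) <= a * u + b * (1 - u).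
Proof.
move=> a0 b0 gab /andP[u0 u1].
have [ab0|ab_neq0] := eqVneq (a + b) 0.
  have a_0 : a = 0 by lra.
  have b_0 : b = 0 by lra.
  move/eqP: gab; rewrite a_0 mul0r sqrf_eq0 => /eqP ->.
  by rewrite b_0; lra.
have ab_gt0 : 0 < a + b by rewrite lt0r ab_neq0 addr_ge0.
(* After multiplication by [a + b], both sides become [a * b] plus a signed remainder, by completing
   the square on the left. *)
rewrite -(ler_pM2r ab_gt0).
have sq : 0 <= (g - l * (a + b)) ^+ 2 by exact: sqr_ge0.
have aau : 0 <= a ^+ 2 * u by rewrite mulr_ge0 ?sqr_ge0.
have bbu : 0 <= b ^+ 2 * (1 - u) by rewrite mulr_ge0 ?sqr_ge0 ?subr_ge0.
have -> : (2 * l * g - l ^+ 2 * (a + b)) * (a + b) =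
    a * b - (g - l * (a + b)) ^+ 2 by rewrite -gab; ring.
have -> : (a * u + b * (1 - u)) * (a + b) =
    a * b + (a ^+ 2 * u + b ^+ 2 * (1 - u)) by ring.
lra.
Qed.

(** Finite functions make the label vectors a finite type, over which risks can be summed. *)
Definition flip_label (m : nat) (j : 'I_m) (y : {ffun 'I_m -> bool}) :
    {ffun 'I_m -> bool} := [ffun k => y k (+) (k == j)].

Lemma flip_labelK (m : nat) (j : 'I_m) : involutive (flip_label j).
Proof. by move=> y; apply/ffunP => k; rewrite !ffunE addbK. Qed.

Lemma flip_label_at (m : nat) (j : 'I_m) (y : {ffun 'I_m -> bool}) :
  flip_label j y j = ~~ y j.
Proof. by rewrite ffunE eqxx addbT. Qed.

Lemma flip_label_neq (m : nat) (j k : 'I_m) (y : {ffun 'I_m -> bool}) :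
  k != j -> flip_label j y k = y k.
Proof. by rewrite ffunE => /negPf ->; rewrite addbF. Qed.

Section Risk.
Variables (R : realType) (n m : nat) (p : 'I_n -> R).
Hypothesis p01 : forall i, 0 <= p i <= 1.

Lemma label_prob_ge0 (y : 'I_m -> bool) X : 0 <= label_prob p y X.
Proof.
apply: prodr_ge0 => j _; apply: prodr_ge0 => i _.
by have /andP[p0 p1] := p01 i; rewrite mulr_ge0 ?exprn_ge0 ?subr_ge0.
Qed.

Lemma sum_label_prob (y : 'I_m -> bool) :
  \sum_(X : 'M[bool]_(n, m)) label_prob p y X = 1.
Proof.
rewrite /label_prob (sum_mx_prod (fun i j b =>
  p i ^+ (b == y j) * (1 - p i) ^+ (b == ~~ y j))).
apply: big1 => j _; apply: big1 => i _; rewrite big_bool /=.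
by case: (y j); rewrite /= !expr0 !expr1; ring.
Qed.

Let s (i : 'I_n) := Num.sqrt (p i * (1 - p i)).

(* The geometric mean of the laws of [X] under [y] and under [y] with its [j]-th
   label flipped. *)
Let geom_prob (j : 'I_m) (y : 'I_m -> bool) (X : 'M[bool]_(n, m)) :=
  \prod_(k < m) \prod_(i < n)
    (if k == j then s i
     else p i ^+ (X i k == y k) * (1 - p i) ^+ (X i k == ~~ y k)).

Lemma geom_prob_sqr j (y : {ffun 'I_m -> bool}) X :
  geom_prob j y X ^+ 2 = label_prob p y X * label_prob p (flip_label j y) X.
Proof.
rewrite -prodrXl -big_split; apply: eq_bigr => k _ /=.
rewrite -prodrXl -big_split; apply: eq_bigr => i _ /=.
have [->|kj] := eqVneq k j; last by rewrite flip_label_neq // expr2.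
have /andP[p0 p1] := p01 i.
rewrite sqr_sqrtr ?mulr_ge0 ?subr_ge0 // flip_label_at.
by case: (X i j); case: (y j); rewrite /= ?expr0 ?expr1; ring.
Qed.

Lemma sum_geom_prob j (y : 'I_m -> bool) :
  \sum_(X : 'M[bool]_(n, m)) geom_prob j y X = \prod_(i < n) (2 * s i).
Proof.
rewrite /geom_prob (sum_mx_prod (fun i k b => if k == j then s i else
  p i ^+ (b == y k) * (1 - p i) ^+ (b == ~~ y k))).
rewrite (bigD1 j) //= [X in _ * X]big1 ?mulr1.
  by apply: eq_bigr => i _; rewrite big_bool eqxx /=; ring.
move=> k /negPf kj; apply: big1 => i _; rewrite big_bool kj /=.
by case: (y k); rewrite /= !expr0 !expr1; ring.
Qed.

Lemma two_point_risk (j : 'I_m) (y : {ffun 'I_m -> bool})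
    (u : 'M[bool]_(n, m) -> R) : (forall X, 0 <= u X <= 1) ->
  (\prod_(i < n) (4 * (p i * (1 - p i)))) / 2 <=
  expectation_py p y (fun X => `|u X - (y j)%:R|) +
  expectation_py p (flip_label j y)
    (fun X => `|u X - (flip_label j y j)%:R|).
Proof.
move=> u01; rewrite flip_label_at /expectation_py -big_split /=.
set rho := \prod_(i < n) (2 * s i).
have -> : \prod_(i < n) (4 * (p i * (1 - p i))) = rho ^+ 2.
  rewrite -prodrXl; apply: eq_bigr => i _; have /andP[p0 p1] := p01 i.
  by rewrite exprMn sqr_sqrtr ?mulr_ge0 ?subr_ge0 //; ring.
(* Both laws have mass 1 and affinity [rho], so the lower bound sums to [2 * l * rho - 2 * l ^+ 2],
   which is largest at [l = rho / 2]. *)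
have -> : rho ^+ 2 / 2 = \sum_(X : 'M[bool]_(n, m))
    (2 * (rho / 2) * geom_prob j y X - (rho / 2) ^+ 2 *
      (label_prob p y X + label_prob p (flip_label j y) X)).
  rewrite sumrB -!mulr_sumr big_split /= sum_geom_prob !sum_label_prob -/rho.
  by field.
apply: ler_sum => X _; have /andP[u0 u1] := u01 X.
have loss (b : bool) : `|u X - b%:R| = if b then 1 - u X else u X.
  by case: b; [rewrite distrC ger0_norm ?subr_ge0 | rewrite subr0 ger0_norm].
rewrite !loss; case: (y j) => /=.
- have -> : label_prob p y X * (1 - u X) + label_prob p (flip_label j y) X * u X
    = label_prob p y X * (1 - u X) +
      label_prob p (flip_label j y) X * (1 - (1 - u X)) by ring.
  apply: mix_ge_geom; rewrite ?label_prob_ge0 ?geom_prob_sqr //.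
  by rewrite subr_ge0 u1 gerBl.
- by apply: mix_ge_geom; rewrite ?label_prob_ge0 ?geom_prob_sqr ?u0.
Qed.

Lemma label_risk_ge (yhat : 'M[bool]_(n, m) -> 'I_m -> R) :
  (0 < m)%N -> is_estimator yhat ->
  exists y : 'I_m -> bool, (\prod_(i < n) (4 * (p i * (1 - p i)))) / 4 <=
    expectation_py p y (fun X => label_loss (yhat X) y).
Proof.
move=> m0 est; set c := \prod_(i < n) _.
pose e j (y : {ffun 'I_m -> bool}) :=
  expectation_py p y (fun X => `|yhat X j - (y j)%:R|).
have riskE (y : {ffun 'I_m -> bool}) :
    expectation_py p y (fun X => label_loss (yhat X) y) =
    m%:R^-1 * \sum_(j < m) e j y.
  rewrite /e /expectation_py exchange_big mulr_sumr; apply: eq_bigr => X _ /=.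
  by rewrite /label_loss mulrCA mulr_sumr.
have avg_e j : \sum_(y : {ffun 'I_m -> bool}) (c / 4) <=
    \sum_(y : {ffun 'I_m -> bool}) e j y.
  (* The flip permutes the label vectors, so the paired sum counts every risk twice. *)
  suff : \sum_(y : {ffun 'I_m -> bool}) (c / 2) <=
      \sum_(y : {ffun 'I_m -> bool}) (e j y + e j (flip_label j y)).
    rewrite big_split /=.
    rewrite -[X in _ + X](reindex_inj (P := predT) (F := e j)
      (inv_inj (@flip_labelK m j))) /=.
    have -> : \sum_(y : {ffun 'I_m -> bool}) (c / 2) =
        2 * \sum_(y : {ffun 'I_m -> bool}) (c / 4).
      by rewrite mulr_sumr; apply: eq_bigr => y _; field.
    lra.
  by apply: ler_sum => y _; apply: two_point_risk => X; exact: est.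
(* If every label vector had risk below [c / 4], so would their average. *)
apply: contrapT => no_y.
have lt_c (y : {ffun 'I_m -> bool}) : m%:R^-1 * \sum_(j < m) e j y < c / 4.
  by rewrite -riskE ltNge; apply/negP => cy; apply: no_y; exists y.
have : \sum_(y : {ffun 'I_m -> bool}) m%:R^-1 * \sum_(j < m) e j y <
    \sum_(y : {ffun 'I_m -> bool}) (c / 4).
  by apply: ltr_sum => //; apply/hasP; exists [ffun => true];
    rewrite ?mem_index_enum.
rewrite ltNge => /negP; apply.
rewrite -[leRHS]mulr_sumr exchange_big /= [leRHS]mulrC.
rewrite ler_pdivlMr ?ltr0n // mulrC.
rewrite mulr_natl -[m in _ *+ m]card_ord -sumr_const.
by apply: ler_sum => j _; exact: avg_e.
Qed.

End Risk.

(** Inverted, this follows from [1 + 2 * x <= expR (2 * x)] and [(1 + 2 * x) * (1 - x) = 1 + x * (1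
    - 2 * x)], which is at least 1 on this range. *)
Lemma expR_le_1B (R : realType) (x : R) :
  0 <= x -> x <= 1 / 2 -> expR (- (2 * x)) <= 1 - x.
Proof.
move=> x0 x1; have x1' : 0 < 1 - x by lra.
rewrite expRN -[leRHS]invrK lef_pV2 ?posrE ?expR_gt0 ?invr_gt0 //.
apply: le_trans (expR_ge1Dx _); rewrite -[leLHS]mul1r ler_pdivrMr //.
nra.
Qed.

Theorem theorem3p3 (R : realType) (n m : nat) (hn : (4 <= n)%N)
    (hm : (1 <= m)%N) (nubar : R) (hnu0 : 0 <= nubar) (hnu : nubar < 1 / 2)
    (yhat : 'M[bool]_(n, m) -> 'I_m -> R) (hyhat : is_estimator yhat) :
  ((1 / (8 * (6 * expR 1) ^+ 2) * expR (- 6 * n%:R * nubar))%:E <=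
   ereal_sup [set r : \bar R |
     exists (y : 'I_m -> bool) (p : 'I_n -> R), ability_class nubar p /\
       r = (expectation_py p y (fun X => label_loss (yhat X) y))%:E])%E.
Proof.
pose t := Num.sqrt nubar.
have t0 : 0 <= t by exact: sqrtr_ge0.
have tE : t ^+ 2 = nubar by rewrite sqr_sqrtr.
have t1 : t <= 1 by rewrite -(@expr_le1 _ 2) // tE; lra.
pose p (_ : 'I_n) : R := (1 + t) / 2.
have p01 i : 0 <= p i <= 1 by rewrite /p; apply/andP; split; lra.
have n0 : n%:R != 0 :> R by rewrite pnatr_eq0 -lt0n (leq_trans _ hn).
have [y risk_y] := label_risk_ge p01 hm hyhat.
apply: (@le_trans _ _
  (expectation_py p y (fun X => label_loss (yhat X) y))%:E); last first.
  apply: ereal_sup_ubound; exists y, p; split=> //; split=> //.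
  rewrite /p sumr_const card_ord -[X in _ * X]mulr_natl mulKf // -tE.
  by field.
rewrite lee_fin; apply: le_trans risk_y.
rewrite /p prodr_const card_ord.
(* This is [4 * p * (1 - p) = 1 - (2 * p - 1) ^+ 2] with [2 * p - 1 = t]. *)
have -> : 4 * ((1 + t) / 2 * (1 - (1 + t) / 2)) = 1 - nubar.
  by rewrite -tE; field.
rewrite [leRHS]mulrC; apply: ler_pM; rewrite ?expR_ge0 //.
(* The bound [expR 1 >= 2] is ample for [8 * (6 * expR 1) ^+ 2 >= 4]. *)
- have e1 := expR_ge1Dx (1 : R).
  by rewrite div1r lef_pV2 ?posrE; nra.
(* Both sides are [n]-th powers, so one factor suffices: [expR (- (6 * nubar)) <= expR (- (2 *
   nubar)) <= 1 - nubar]. *)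
- have -> : - 6 * n%:R * nubar = n%:R * (- (6 * nubar)) by ring.
  rewrite expRM_natl lerXn2r ?nnegrE ?expR_ge0 //; first by lra.
  apply: le_trans (expR_le_1B hnu0 (ltW hnu)).
  by rewrite ler_expR; lra.
Qed.
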